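(* Let $R$ be an $h$-local Prüfer domain. A countable rank, torsion-free $R$-module $M$ is isomorphic to a direct sum of ideals of $R$ if and only if every finite rank, pure submodule of $M$ is isomorphic to a direct sum of ideals of $R$.
   Context: A Prüfer domain is an integral domain in which every finitely generated ideal is projective. An integral domain $R$ is $h$-local if (i) every nonzero prime ideal of $R$ is contained in exactly one maximal ideal, and (ii) every nonzero element of $R$ is contained in only finitely many maximal ideals. A submodule $N$ of an $R$-module $M$ is pure in $M$ if every finite system of equations $\sum_{j=1}^m r_{ij}x_j = a_i \in N$ ($i=1,\dots,n$), with $r_{ij}\in R$, is solvable in $N$ whenever it is solvable in $M$. The rank of a torsion-free $R$-module is the cardinality of a maximal $R$-linearly independent subset. Countable means finite or countably infinite. Direct sums of ideals are direct sums of ideals of $R$ regarded as $R$-modules. *)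

(* Defs.v *)
From HB Require Import structures.
From mathcomp Require Import all_boot all_order all_algebra.
From mathcomp Require Import all_classical.

Set Implicit Arguments.
Unset Strict Implicit.
Unset Printing Implicit Defensive.

Import GRing.Theory.
Local Open Scope classical_set_scope.
Local Open Scope ring_scope.

Record submodule (R : pzRingType) (M : lmodType R) := Submodule {
  submod_set :> set M;
  submod_setP : submod_closed (mem submod_set) }.

Section SubmoduleLmod.
Variables (R : pzRingType) (M : lmodType R) (N : submodule M).

Definition submod_sort : Type := {x : M | x \in submod_set N}.

HB.instance Definition _ := SubChoice.on submod_sort.

Fact submod_sort_closed : subsemimod_closed (fun x => x \in submod_set N).
Proof. exact: GRing.submod_closed_semi (submod_setP N). Qed.

HB.instance Definition _ :=
  GRing.SubChoice_isSubLmodule.Build R M _ submod_sort submod_sort_closed.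

Definition submod_lmod : lmodType R := submod_sort.

End SubmoduleLmod.

Coercion submod_lmod : submodule >-> GRing.Lmodule.type.

Section Modules.
Variable R : pzRingType.
Implicit Types (V W : lmodType R).

Definition lmod_isomorphic V W : Prop :=
  exists f : {linear V -> W}, bijective f.

Definition finitely_generated V : Prop :=
  exists (n : nat) (g : 'I_n -> V),
    forall x : V, exists a : 'I_n -> R, x = \sum_i a i *: g i.

Definition projective V : Prop :=
  forall (A B : lmodType R) (g : {linear A -> B}) (f : {linear V -> B}),
    (forall b : B, exists a : A, g a = b) ->
    exists h : {linear V -> A}, forall x : V, g (h x) = f x.

Definition torsion_free V : Prop :=
  forall (a : R) (x : V), a *: x = 0 -> a = 0 \/ x = 0.

Definition lin_indep V (B : set V) : Prop :=
  forall (s : seq V) (a : V -> R), uniq s -> [set` s] `<=` B ->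
    \sum_(x <- s) a x *: x = 0 -> forall x, x \in s -> a x = 0.

Definition max_lin_indep V (B : set V) : Prop :=
  lin_indep B /\ forall C : set V, lin_indep C -> B `<=` C -> C = B.

(* Over a domain all maximal linearly independent subsets of a torsion-free
   module have the same cardinality, namely the rank. *)
Definition finite_rank V : Prop :=
  exists B : set V, max_lin_indep B /\ finite_set B.

Definition countable_rank V : Prop :=
  exists B : set V, max_lin_indep B /\ countable B.

Definition pure V (N : submodule V) : Prop :=
  forall (n m : nat) (r : 'I_n -> 'I_m -> R) (a : 'I_n -> V),
    (forall i, submod_set N (a i)) ->
    (exists x : 'I_m -> V, forall i, \sum_j r i j *: x j = a i) ->
    exists x : 'I_m -> V,
      (forall j, submod_set N (x j)) /\ (forall i, \sum_j r i j *: x j = a i).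

End Modules.

(* The unit ideal is allowed, unlike for the library predicate idealr_closed. *)
Definition ideal (R : comNzRingType) := submodule R^o.

Section Ideals.
Variable R : idomainType.
Implicit Types I J P : ideal R.

Definition ideal_neq1 I : Prop := ~ submod_set I 1.

Definition prime_ideal P : Prop :=
  ideal_neq1 P /\ forall a b : R, submod_set P (a * b) -> submod_set P a \/ submod_set P b.

Definition maximal_ideal I : Prop :=
  ideal_neq1 I /\ forall J, ideal_neq1 J -> I `<=` J -> J = I.

Definition nonzero_ideal I : Prop := exists2 a : R, submod_set I a & a <> 0.

End Ideals.

Definition prufer_domain (R : idomainType) : Prop :=
  forall I : ideal R, finitely_generated I -> projective I.

Definition h_local (R : idomainType) : Prop :=
  (forall P : ideal R, prime_ideal P -> nonzero_ideal P ->
     exists! m : ideal R, maximal_ideal m /\ P `<=` m) /\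
  (forall a : R, a <> 0 ->
     finite_set [set m : ideal R | maximal_ideal m /\ submod_set m a]).

Section DirectSum.
Variables (R : idomainType) (I : Type) (J : I -> ideal R).

Definition direct_sum_set : set (I -> R^o) :=
  [set f | (forall i, submod_set (J i) (f i)) /\ finite_set [set i | f i <> 0]].

Fact direct_sum_closed : submod_closed (mem direct_sum_set).
Proof.
split=> [|a u v /set_mem[Ju fu] /set_mem[Jv fv]]; apply/mem_set; split.
- by move=> i; have [/set_mem] := submod_setP (J i).
- rewrite (_ : [set _ | _] = set0); first exact: finite_set0.
  by apply/seteqP; split=> i //= ; apply.
- move=> i; have [_ Jlin] := submod_setP (J i).
  by apply/set_mem/(Jlin a); apply/mem_set.
- apply: (@sub_finite_set _ _ ([set i | u i <> 0] `|` [set i | v i <> 0])).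
    move=> i /= auv; have [ui0|] := EM (u i = 0); last by left.
    right=> vi0; apply: auv.
    by change (a *: u i + v i = 0); rewrite ui0 vi0 scaler0 addr0.
  by rewrite finite_setU.
Qed.

(* The external direct sum of the J i: finitely supported families. *)
Definition direct_sum : submodule (I -> R^o) := Submodule direct_sum_closed.

End DirectSum.

Definition iso_direct_sum_of_ideals (R : idomainType) (M : lmodType R) : Prop :=
  exists (I : Type) (J : I -> ideal R), lmod_isomorphic M (direct_sum J).

(* Main.v *)
(** If A and B are ideals of R then r A <= B and (1 - r) B <= A for some r.
    Otherwise some maximal ideal m contains (A : B) + (B : A); since R is
    Prufer, A and B are comparable locally at m, say A_m <= B_m, and h-locality
    lets one clear denominators: r A <= B for some r outside m.  Hence for
    finitely many nonzero fractional ideals A_i there is a partition of unity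
    1 = sum e_i with e_i A_i contained in every A_j.  Applied to A_i = J_i / x_i,
    this says that the line through x = (x_i) is a direct summand of the direct
    sum of the J_i.  This property of lines passes to pure submodules, and
    splitting off one line at a time shows that in a filtration by pure
    submodules of rank n, the n-th one is a summand of the next, with a
    complement embedding in R.  Both implications follow; for the converse one
    also needs that saturated submodules are pure over R. *)
Require Import Defs.
From HB Require Import structures.
From mathcomp Require Import all_boot all_order all_algebra.
From mathcomp Require Import all_classical ring.

Set Implicit Arguments.
Unset Strict Implicit.
Unset Printing Implicit Defensive.

Import GRing.Theory.
Local Open Scope classical_set_scope.
Local Open Scope ring_scope.

(** * Closure properties of submodules; building submodules and linear maps *)

Section Submodules.
Variables (R : pzRingType) (M : lmodType R).

Lemma submod0 (N : submodule M) : submod_set N 0.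
Proof. by have [/set_mem] := submod_setP N. Qed.

Lemma submodZD (N : submodule M) (a : R) (u v : M) :
  submod_set N u -> submod_set N v -> submod_set N (a *: u + v).
Proof.
move=> Nu Nv; have [_ Nl] := submod_setP N.
by apply/set_mem/(Nl a); apply/mem_set.
Qed.

Lemma submodD (N : submodule M) (u v : M) :
  submod_set N u -> submod_set N v -> submod_set N (u + v).
Proof. by move=> Nu Nv; rewrite -[u]scale1r; apply: submodZD. Qed.

Lemma submodZ (N : submodule M) (a : R) (u : M) :
  submod_set N u -> submod_set N (a *: u).
Proof. by move=> Nu; rewrite -[_ *: _]addr0; apply: submodZD => //; exact: submod0. Qed.

Lemma submodB (N : submodule M) (u v : M) :
  submod_set N u -> submod_set N v -> submod_set N (u - v).
Proof. by move=> Nu Nv; rewrite -scaleN1r addrC; apply: submodZD. Qed.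

Lemma submod_sum (N : submodule M) (I : Type) (s : seq I) (P : pred I) (F : I -> M) :
  (forall i, P i -> submod_set N (F i)) -> submod_set N (\sum_(i <- s | P i) F i).
Proof.
move=> NF; apply: (big_ind (submod_set N)) => //; first exact: submod0.
by move=> u v; apply: submodD.
Qed.

Lemma submodule_of_set (N : set M) : N 0 ->
  (forall (a : R) u v, N u -> N v -> N (a *: u + v)) ->
  exists N' : submodule M, submod_set N' = N.
Proof.
move=> N0 Nl; have NC : submod_closed (mem N).
  by split=> [|a u v /set_mem Nu /set_mem Nv]; apply/mem_set => //; apply: Nl.
by exists (Submodule NC).
Qed.

Lemma submodule_ext (N N' : submodule M) : submod_set N = submod_set N' -> N = N'.
Proof.
case: N N' => [N NP] [N' NP'] /= NN'.
by case: _ / NN' NP' => NP'; congr Submodule; apply: Prop_irrelevance.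
Qed.

Lemma linear_of_fun (W : lmodType R) (f : M -> W) :
  (forall (a : R) u v, f (a *: u + v) = a *: f u + f v) ->
  exists g : {linear M -> W}, g =1 f.
Proof.
move=> fL; pose m := GRing.isLinear.Build R M W *:%R f fL.
pose g : {linear M -> W} := HB.pack f m.
by exists g.
Qed.

End Submodules.

(** * Primes, maximal ideals and comparison of ideals *)

Section Comparison.
Variable R : idomainType.
Implicit Types (I A B : ideal R).

Lemma ideal_mull I (a x : R) : submod_set I x -> submod_set I (a * x).
Proof. by move=> Ix; apply: (submodZ (N := I) a Ix). Qed.

Lemma ideal_mulr I (a x : R) : submod_set I x -> submod_set I (x * a).
Proof. by rewrite mulrC; apply: ideal_mull. Qed.

Lemma ideal_maximal_disjoint I (S : set R) : (forall x, submod_set I x -> ~ S x) ->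
  exists P : ideal R, [/\ I `<=` P, forall x, submod_set P x -> ~ S x &
    forall J : ideal R, P `<=` J -> (forall x, submod_set J x -> ~ S x) -> J = P].
Proof.
move=> IS.
pose good (X : set R) := exists2 J : ideal R, submod_set J = X &
  I `<=` J /\ forall x, submod_set J x -> ~ S x.
pose P (X : set R) := X = set0 \/ good X.
have [F FP totF|A [PA Amax]] := @Zorn_bigcup R P.
  have [[X FX [x Xx]]|F0] := EM (exists2 X, F X & X !=set0); last first.
    left; apply/seteqP; split=> // x [X FX Xx].
    by apply: F0; exists X => //; exists x.
  right.
  have FP' Y y : F Y -> Y y -> good Y.
    by move=> FY Yy; have [Y0|] := FP _ FY; first by rewrite Y0 in Yy.
  have [U UE] : exists U : ideal R, submod_set U = \bigcup_(Z in F) Z.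
    apply: (submodule_of_set (R := R) (M := R^o)) => /=.
      exists X => //; have [J <- _] := FP' _ _ FX Xx; exact: submod0.
    move=> a u v [Y FY Yu] [Z FZ Zv].
    have [YZ|ZY] := totF _ _ FY FZ.
      exists Z => //; have [J JZ _] := FP' _ _ FZ Zv.
      by rewrite -JZ in YZ Zv *; apply: submodZD => //; apply: YZ.
    exists Y => //; have [J JY _] := FP' _ _ FY Yu.
    by rewrite -JY in ZY Yu *; apply: submodZD => //; apply: ZY.
  exists U => //; rewrite UE; split.
    move=> y Iy; exists X => //; have [J <- [IJ _]] := FP' _ _ FX Xx; exact: IJ.
  by move=> y [Y FY Yy]; have [J JE [_ JS]] := FP' _ _ FY Yy; apply: JS; rewrite JE.
have {PA} [J JA [IJ JS]] : good A.
  case: PA => // A0; exfalso; apply: (Amax I); last by right; exists I; last split.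
  rewrite A0; split=> // H; apply: (H 0); exact: submod0.
exists J; split=> // K JK KS; apply/submodule_ext.
apply: contrapT => KJ; apply: (Amax K); last first.
  by right; exists K => //; split=> //; apply: subset_trans IJ JK.
split; first by rewrite -JA.
by rewrite -JA => KJ'; apply: KJ; apply/seteqP.
Qed.

Lemma ideal_add I (a : R) : exists J : ideal R,
  forall x, submod_set J x <-> exists i r, submod_set I i /\ x = i + r * a.
Proof.
have [||J JE] := @submodule_of_set R R^o
  [set x : R | exists i r, submod_set I i /\ x = i + r * a].
- by exists 0, 0; split; [exact: submod0 | rewrite mul0r addr0].
- move=> c u v [i [r [Ii ->]]] [j [s [Ij ->]]].
  exists (c * i + j), (c * r + s); split; first exact: (submodZD (N := I)).
  by change (c * (i + r * a) + (j + s * a) = c * i + j + (c * r + s) * a);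
     rewrite mulrDr mulrDl mulrA addrACA.
by exists J => x; rewrite JE.
Qed.

(** If [a] and [b] lie outside [P], maximality makes both [P + Ra] and [P + Rb] meet [S]. The
    product of two such elements is in [S] and in [P + Rab], so [ab] is not in [P]. *)
Lemma prime_of_maximal_disjoint (P : ideal R) (S : set R) : S 1 ->
  (forall x y, S x -> S y -> S (x * y)) -> (forall x, submod_set P x -> ~ S x) ->
  (forall J : ideal R, P `<=` J -> (forall x, submod_set J x -> ~ S x) -> J = P) ->
  prime_ideal P.
Proof.
move=> S1 SM PS Pmax; split; first by move=> P1; exact: PS P1 S1.
have meetS a : ~ submod_set P a -> exists i r, submod_set P i /\ S (i + r * a).
  move=> nPa; apply: contrapT => H; apply: nPa.
  have [J JE] := ideal_add P a.
  rewrite -(Pmax J).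
  - by apply/JE; exists 0, 1; split; [exact: submod0 | rewrite add0r mul1r].
  - by move=> x Px; apply/JE; exists x, 0; rewrite mul0r addr0.
  by move=> x /JE[i [r [Pi ->]]] Sx; apply: H; exists i, r.
move=> a b Pab; apply: contrapT => /not_orP[/meetS[i [r [Pi Sa]]] /meetS[j [s [Pj Sb]]]].
apply: (PS _ _ (SM _ _ Sa Sb)).
rewrite mulrDl; apply: (submodD (N := P)); first exact: ideal_mulr.
rewrite mulrDr; apply: (submodD (N := P)); first exact: ideal_mull.
by rewrite mulrACA; apply: ideal_mull.
Qed.

Lemma exists_maximal_ideal I : ideal_neq1 I ->
  exists2 m : ideal R, maximal_ideal m & I `<=` m.
Proof.
move=> I1; have [|m [Im m1 mmax]] := @ideal_maximal_disjoint I [set 1].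
  by move=> x Ix x1; apply: I1; rewrite -x1.
exists m => //; split; first by move=> /m1; apply.
by move=> J J1 mJ; apply: mmax => // x Jx x1; apply: J1; rewrite -x1.
Qed.

Lemma maximal_ideal_prime (m : ideal R) : maximal_ideal m -> prime_ideal m.
Proof.
move=> [m1 mmax]; apply: (@prime_of_maximal_disjoint m [set 1]) => //.
- by move=> x y /= -> ->; rewrite mulr1.
- by move=> x mx x1; apply: m1; rewrite -x1.
- by move=> J mJ J1; apply: mmax => // J1'; apply: (J1 1).
Qed.

Lemma prime_ideal_prod (P : ideal R) (T : eqType) (s : seq T) (F : T -> R) :
  prime_ideal P -> submod_set P (\prod_(i <- s) F i) ->
  exists2 i, i \in s & submod_set P (F i).
Proof.
move=> [P1 PM]; elim: s => [|i s IHs]; first by rewrite big_nil.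
rewrite big_cons => /PM[Pi|/IHs[j js Pj]]; first by exists i => //; apply: mem_head.
by exists j => //; rewrite inE js orbT.
Qed.

(** At a maximal ideal one of [u], [1 - u] is a unit, so [a] and [b] are comparable under
    divisibility there. The coefficients are coordinates of a section [h] of the surjection from
    [R^2] onto the projective ideal [(a, b)]. *)
Lemma prufer_comparable (a b : R) : prufer_domain R ->
  exists u c d, u * a = c * b /\ (1 - u) * b = d * a.
Proof.
move=> prufR; have [->|/eqP a0] := eqVneq a 0.
  by exists 1, 0, 0; rewrite subrr !mul0r mulr0.
have [||I IE] := @submodule_of_set R R^o [set x : R | exists p q, x = p * a + q * b].
- by exists 0, 0; rewrite !mul0r addr0.
- move=> c u v [p [q ->]] [p' [q' ->]]; exists (c * p + p'), (c * q + q').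
  change (c * (p * a + q * b) + (p' * a + q' * b) = (c * p + p') * a + (c * q + q') * b).
  by rewrite mulrDr !mulrDl !mulrA addrACA.
have IP x : submod_set I x -> exists p q, x = p * a + q * b by rewrite IE.
have Ia : submod_set I a by rewrite IE; exists 1, 0; rewrite mul1r mul0r addr0.
have Ib : submod_set I b by rewrite IE; exists 0, 1; rewrite mul1r mul0r add0r.
pose ia : I := exist _ a (mem_set Ia); pose ib : I := exist _ b (mem_set Ib).
have Ifg : finitely_generated I.
  exists 2%N, (fun i : 'I_2 => if i == 0 then ia else ib).
  move=> x; have [p [q xE]] := IP _ (set_mem (valP x)).
  exists (fun i : 'I_2 => if i == 0 then p else q).
  rewrite !big_ord_recr big_ord0 /= add0r; apply: val_inj.
  by rewrite [LHS]xE.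
have gL (c : R) (u v : (R^o * R^o)%type) : (c *: u + v).1 *: ia + (c *: u + v).2 *: ib =
  c *: (u.1 *: ia + u.2 *: ib) + (v.1 *: ia + v.2 *: ib).
  rewrite /= !scalerDl scalerDr !scalerA addrACA; congr (_ + _ + (_ + _)).
have [g gE] := linear_of_fun gL.
have [|h hE] := prufR I Ifg (R^o * R^o)%type _ g idfun.
  move=> x; have [p [q xE]] := IP _ (set_mem (valP x)).
  by exists (p, q); rewrite gE; apply: val_inj; rewrite [RHS]xE.
(* Both sides are the value of [h] at the product of [x] and [y]. *)
have hC (x y : I) : (val x : R) *: h y = (val y : R) *: h x.
  rewrite -!linearZ; congr (h _); apply: val_inj.
  by change ((val x : R) * val y = (val y : R) * val x); rewrite mulrC.
have /(congr1 (fun z => (val z : R))) := hE ia; rewrite gE /=.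
have := hC ia ib; case: (h ia) (h ib) => [fa ga] [fb gb] /= [] hC1 hC2.
change (fa * a + ga * b = a -> exists u c d : R, u * a = c * b /\ (1 - u) * b = d * a).
have {}hC1 : a * fb = b * fa by []. have {}hC2 : a * gb = b * ga by [].
move=> E; have gb1 : 1 - gb = fa.
  apply: (mulfI (introN eqP a0)).
  by rewrite mulrBr mulr1 -[X in X - _]E hC2 [ga * b]mulrC addrK mulrC.
exists gb, ga, fb; rewrite gb1.
by split; [rewrite mulrC hC2 mulrC | rewrite mulrC -hC1 mulrC].
Qed.

Lemma principal_ideal (b : R) : exists I : ideal R,
  forall x, submod_set I x <-> exists c, x = c * b.
Proof.
have [||I IE] := @submodule_of_set R R^o [set x : R | exists c, x = c * b].
- by exists 0; rewrite mul0r.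
- move=> c u v [p ->] [q ->]; exists (c * p + q).
  by change (c * (p * b) + q * b = (c * p + q) * b); rewrite mulrDl mulrA.
by exists I => x; rewrite IE.
Qed.

(* Otherwise a prime containing b and avoiding the products s * t would be
   nonzero and lie in both m and n. *)
Lemma h_local_separation (m n : ideal R) (b : R) : h_local R ->
  maximal_ideal m -> maximal_ideal n -> m <> n -> b <> 0 ->
  exists s t c, [/\ ~ submod_set m s, ~ submod_set n t & s * t = c * b].
Proof.
move=> [hl _] maxm maxn mn b0.
pose S := [set x : R | exists s t, [/\ ~ submod_set m s, ~ submod_set n t & x = s * t]].
have [I IE] := principal_ideal b.
apply: contrapT => nst.
have [|P [IP PS Pmax]] := @ideal_maximal_disjoint I S.
  by move=> x /IE[c ->] [s [t [ms nt /esym st]]]; apply: nst; exists s, t, c.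
have [m1 mM] := maximal_ideal_prime maxm.
have [n1 nM] := maximal_ideal_prime maxn.
have Pprime : prime_ideal P.
  apply: (@prime_of_maximal_disjoint P S) => //; first by exists 1, 1; rewrite mulr1.
  move=> _ _ [s [t [ms nt ->]]] [s' [t' [ms' nt' ->]]].
  by exists (s * s'), (t * t'); split; [move=> /mM[] | move=> /nM[] | rewrite mulrACA].
have [|q [_ qu]] := hl P Pprime.
  by exists b => //; apply: IP; apply/IE; exists 1; rewrite mul1r.
have sub x : submod_set P x -> submod_set m x /\ submod_set n x.
  move=> Px; split; apply: contrapT => nx; apply: (PS x Px).
    by exists x, 1; rewrite mulr1.
  by exists 1, x; rewrite mul1r.
have qm : q = m by apply: qu; split=> // x /sub[].
have qn : q = n by apply: qu; split=> // x /sub[].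
by apply: mn; rewrite -qm.
Qed.

Lemma colon_ideal (x : R) A : exists J : ideal R,
  forall r, submod_set J r <-> submod_set A (r * x).
Proof.
have [||J JE] := @submodule_of_set R R^o [set r : R | submod_set A (r * x)].
- by rewrite /= mul0r; exact: submod0.
- move=> c u v Au Av; change (submod_set A ((c * u + v) * x)).
  by rewrite mulrDl -mulrA; apply: (submodZD (N := A)).
by exists J => r; rewrite JE.
Qed.

(** Only finitely many maximal ideals [n] other than [m] contain [b]; [r] is the product of elements
    [f n] outside [m] separating [m] from each of them. For [a] in [A], the ideal [(B : r a)] lies
    in no maximal ideal: not in [m] by hypothesis, not in one avoiding [b] since [b] belongs to it,
    and not in a remaining [n] since it contains the cofactor [t] of [f n], which is outside [n]. *)
Lemma h_local_clear_denominators (m : ideal R) A B : h_local R ->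
  maximal_ideal m -> nonzero_ideal B ->
  (forall a, submod_set A a -> exists2 s, ~ submod_set m s & submod_set B (s * a)) ->
  exists2 r, ~ submod_set m r & forall a, submod_set A a -> submod_set B (r * a).
Proof.
move=> hl maxm [b Bb b0] AB.
have /(@finite_seqP {classic ideal R})[ns nsE] :
    finite_set [set n : ideal R | (maximal_ideal n /\ submod_set n b) /\ n <> m].
  by apply: sub_finite_set (hl.2 b b0) => n [].
have sepP (n : {classic ideal R}) : exists s, n \in ns ->
    ~ submod_set m s /\ exists t c, ~ submod_set n t /\ s * t = c * b.
  have [nns|] := boolP (n \in ns); last by exists 0.
  have : [set` ns] n by []; rewrite -nsE => -[[maxn nb] nm].
  have [s [t [c [ms nt st]]]] :=
    h_local_separation hl maxm maxn (fun e => nm (esym e)) b0.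
  by exists s => _; split=> //; exists t, c.
have {sepP}[f fP] := choice sepP.
exists (\prod_(n <- ns) f n).
  move=> /(prime_ideal_prod (maximal_ideal_prime maxm))[n nns].
  by have [] := fP n nns.
move=> a Aa; have [J JE] := colon_ideal (\prod_(n <- ns) f n * a) B.
suff : submod_set J 1 by rewrite JE mul1r.
apply: contrapT => /exists_maximal_ideal[n maxn Jn].
have [nm|nm] := EM (n = m).
  have [s ms Bsa] := AB a Aa; apply: ms; rewrite -nm; apply/Jn/JE.
  by rewrite mulrCA; apply: ideal_mull.
have nb : submod_set n b by apply/Jn/JE; exact: ideal_mulr.
have nns : (n : {classic ideal R}) \in ns.
  by have : [set` ns] n; [rewrite -nsE | ].
have [_ [t [c [nt st]]]] := fP n nns; apply: nt; apply/Jn/JE.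
rewrite (big_rem _ nns) /= -!mulrA mulrA [t * _]mulrC st -mulrA.
by apply: ideal_mull; apply: ideal_mulr.
Qed.

Lemma ideal_comparable A B : prufer_domain R -> h_local R ->
  exists r : R, (forall a, submod_set A a -> submod_set B (r * a)) /\
    (forall b, submod_set B b -> submod_set A ((1 - r) * b)).
Proof.
move=> prufR hl.
have [nzA|zA] := EM (nonzero_ideal A); last first.
  have A0 a : submod_set A a -> a = 0.
    by move=> Aa; apply: contrapT => a0; apply: zA; exists a.
  exists 1; rewrite subrr; split=> [a /A0->|b _]; rewrite ?mulr0 ?mul0r;
    exact: submod0.
have [nzB|zB] := EM (nonzero_ideal B); last first.
  have B0 b : submod_set B b -> b = 0.
    by move=> Bb; apply: contrapT => b0; apply: zB; exists b.
  exists 0; rewrite subr0; split=> [a _|b /B0->]; rewrite ?mulr0 ?mul0r;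
    exact: submod0.
(* [J] is [(B : A) + (A : B)]; the claim is that it is the unit ideal. *)
have [||J JE] := @submodule_of_set R R^o [set x : R | exists r s, [/\ x = r + s,
    (forall a, submod_set A a -> submod_set B (r * a)) &
    (forall b, submod_set B b -> submod_set A (s * b))]].
- exists 0, 0; split; rewrite ?addr0 // => a _; rewrite mul0r; exact: submod0.
- move=> c _ _ [r [s [-> rA sB]]] [r' [s' [-> rA' sB']]].
  exists (c * r + r'), (c * s + s'); split.
  + by change (c * (r + s) + (r' + s') = c * r + r' + (c * s + s'));
       rewrite mulrDr addrACA.
  + move=> a Aa; rewrite mulrDl -mulrA; apply: (submodZD (N := B)); auto.
  + move=> b Bb; rewrite mulrDl -mulrA; apply: (submodZD (N := A)); auto.
suff : submod_set J 1.
  rewrite JE => -[r [s [rs rA sB]]]; exists r; split=> //.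
  by rewrite rs addrC addKr.
apply: contrapT => /exists_maximal_ideal[m maxm Jm].
have [m1 mM] := maxm.
have [AB|nAB] := EM (forall a, submod_set A a ->
    exists2 s, ~ submod_set m s & submod_set B (s * a)).
  have [r mr rA] := h_local_clear_denominators hl maxm nzB AB.
  apply: mr; apply: Jm; rewrite JE; exists r, 0; split; rewrite ?addr0 //.
  by move=> b _; rewrite mul0r; exact: submod0.
have [BA|nBA] := EM (forall b, submod_set B b ->
    exists2 s, ~ submod_set m s & submod_set A (s * b)).
  have [r mr rB] := h_local_clear_denominators hl maxm nzA BA.
  apply: mr; apply: Jm; rewrite JE; exists 0, r; split; rewrite ?add0r //.
  by move=> a _; rewrite mul0r; exact: submod0.
(* Now neither of [A_m], [B_m] contains the other, with witnesses [a] and [b]. But whichever of [u],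
   [1 - u] is outside [m] multiplies [a] into [B] or [b] into [A]. *)
move/existsNP: nAB => [a /not_implyP[Aa na]].
move/existsNP: nBA => [b /not_implyP[Bb nb]].
have [u [c [d [uE vE]]]] := prufer_comparable a b prufR.
apply: m1; have -> : 1 = u + (1 - u) by rewrite addrCA subrr addr0.
apply: (submodD (N := m)); apply: contrapT => mu.
- by apply: na; exists u => //; rewrite uE; apply: ideal_mull.
- by apply: nb; exists (1 - u) => //; rewrite vE; apply: ideal_mull.
Qed.

Lemma ideal_comparable_seq (T : eqType) (s : seq T) (A : T -> ideal R) :
  prufer_domain R -> h_local R -> s != [::] -> uniq s ->
  exists e : T -> R, \sum_(i <- s) e i = 1 /\
    forall i j a, i \in s -> j \in s -> submod_set (A i) a -> submod_set (A j) (e i * a).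
Proof.
move=> prufR hl; elim: s => [//|x s IHs] _ /=.
have [->|s0] := eqVneq s [::].
  move=> _; exists (fun=> 1); rewrite big_seq1; split=> // i j a.
  by rewrite !inE => /eqP-> /eqP-> Aa; rewrite mul1r.
move=> /andP[xs us]; have [e [e1 eP]] := IHs s0 us.
have [r rP] := choice (fun i => ideal_comparable (A i) (A x) prufR hl).
(* Each old weight [e i] is split by [1 = r i + (1 - r i)]. The part [e i * r i] stays at [i], as
   [r i] maps [A i] into [A x]. The rest goes to [x], as [1 - r i] maps [A x] into [A i], and [e i]
   then maps it into every [A j]. *)
exists (fun i => if i == x then \sum_(i <- s) e i * (1 - r i) else e i * r i).
split.
  rewrite big_cons eqxx; under eq_big_seq => i iS.
    have /negPf-> : i != x by apply: contraNneq xs => <-.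
    over.
  by rewrite -big_split -[RHS]e1; apply: eq_bigr => i _ /=; rewrite -mulrDr subrK mulr1.
move=> i j a; rewrite !inE; have [->|ix] /= := eqVneq i x.
  have [->|jx] /= := eqVneq j x; first by move=> _ _; apply: ideal_mull.
  move=> _ js Aa; rewrite mulr_suml big_seq; apply: (submod_sum (N := A j)) => k ks.
  by rewrite -mulrA; apply: eP => //; apply: (rP k).2.
move=> iS jS Aa; rewrite -mulrA.
have [->|jx] /= := eqVneq j x; first by apply: ideal_mull; apply: (rP i).1.
by move: jS; rewrite (negPf jx) /= => jS; rewrite mulrCA; apply: ideal_mull; apply: eP.
Qed.

End Comparison.

(** The partition of unity for the fractional ideals [J_t / x_t], with the inclusion of
    [e_t J_t / x_t] in [J_u / x_u] written without denominators. Multiplying by the product [d] of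
    the [x_t] reduces it to the ideals [A_t = (d / x_t) J_t] of [R]. *)
Lemma fractional_ideal_comparable (R : idomainType) (T : eqType) (s : seq T)
    (x : T -> R) (J : T -> ideal R) :
  prufer_domain R -> h_local R -> s != [::] -> uniq s ->
  (forall t, t \in s -> x t != 0) ->
  exists e : T -> R, \sum_(t <- s) e t = 1 /\
    forall t u y, t \in s -> u \in s -> submod_set (J t) y ->
      exists2 z, submod_set (J u) z & e t * y * x u = x t * z.
Proof.
move=> prufR hl s0 us x0; pose d := \prod_(t <- s) x t.
have AP t : exists A : ideal R, forall a, submod_set A a <->
    exists2 j, submod_set (J t) j & a * x t = d * j.
  have [||A AE] := @submodule_of_set R R^o
    [set a : R | exists2 j, submod_set (J t) j & a * x t = d * j].
  - by exists 0; [exact: submod0 | rewrite mul0r mulr0].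
  - move=> c u v [i Ji uE] [j Jj vE]; exists (c * i + j).
      exact: (submodZD (N := J t)).
    change ((c * u + v) * x t = d * (c * i + j)).
    by rewrite mulrDl mulrDr -mulrA uE vE mulrCA.
  by exists A => a; rewrite AE.
have {AP}[A AP] := choice AP.
have [e [e1 eP]] := ideal_comparable_seq A prufR hl s0 us.
exists e; split=> // t u y ts us' Jy.
have dE : d = x t * \prod_(v <- rem t s) x v by rewrite /d (big_rem _ ts).
set D := \prod_(v <- rem t s) x v in dE.
have D0 : D != 0.
  rewrite /D prodf_seq_neq0; apply/allP => v /mem_rem vs /=; exact: x0.
have /(eP t u _ ts us')/AP[z Jz zE] : submod_set (A t) (D * y).
  by apply/AP; exists y; rewrite // dE mulrAC [D * x t]mulrC.
exists z => //; apply: (mulfI D0).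
by transitivity (d * z); [rewrite -zE | rewrite dE]; ring.
Qed.

(** * Modules in which every line is a direct summand *)

Section LineSplit.
Variable R : idomainType.
Implicit Types V : lmodType R.

(** Equivalently, [V / N] is torsion-free. In a torsion-free [V] this is purity for one equation in
    one unknown. *)
Definition saturated V (N : submodule V) : Prop :=
  forall (r : R) y, r <> 0 -> submod_set N (r *: y) -> submod_set N y.

Lemma scaler_tfI V (r : R) (u v : V) :
  torsion_free V -> r <> 0 -> r *: u = r *: v -> u = v.
Proof.
move=> tf r0 /eqP; rewrite -subr_eq0 -scalerBr => /eqP/tf[//|/eqP].
by rewrite subr_eq0 => /eqP.
Qed.

Lemma torsion_free_submod V (N : submodule V) : torsion_free V -> torsion_free N.
Proof.
move=> tf a x /(congr1 val); rewrite linearZ linear0 => /tf[]; first by left.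
by move=> x0; right; apply: val_inj.
Qed.

Lemma pure_saturated V (N : submodule V) : torsion_free V -> pure N -> saturated N.
Proof.
move=> tf pN r y r0 Nry.
have [||x [Nx xE]] := pN 1%N 1%N (fun _ _ => r) (fun=> r *: y) => //.
  by exists (fun=> y) => i; rewrite big_ord1.
have := xE ord0; rewrite big_ord1 => /(scaler_tfI tf r0) <-; exact: Nx.
Qed.

(* The line through x is a direct summand, with projection
   y |-> (L y / L x) *: x. *)
Definition lines_split V : Prop := forall x : V, x <> 0 ->
  exists2 L : {linear V -> R^o}, L x <> 0 & forall y, exists z, L x *: z = L y *: x.

(** The functional [L] restricts to [N]. The quotient [z] stays in [N] because its multiple
    [L x *: z = L y *: x] does. *)
Lemma lines_split_submod V (N : submodule V) :
  saturated N -> lines_split V -> lines_split N.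
Proof.
move=> satN lsV x x0; have [|L Lx0 LP] := lsV (val x).
  by move=> vx; apply: x0; apply: val_inj.
have [L' L'E] : exists L' : {linear N -> R^o}, L' =1 (fun y => L (val y)).
  by apply: linear_of_fun => a u v; rewrite !linearP.
exists L' => [|y]; rewrite !L'E //; have [z zE] := LP (val y).
have Nz : submod_set N z.
  by apply: (satN (L (val x))) => //; rewrite zE; apply: submodZ; apply: set_mem; apply: valP.
by exists (exist _ z (mem_set Nz)); apply: val_inj; rewrite !linearZ.
Qed.

(** Let [s] be the support of [x], [d] the product of its coordinates there, and [e] the partition
    of unity for the [J_t / x_t]. The functional is [L y = d \sum_t e_t y_t / x_t], so that
    [L x = d]; in the code [D t] is [d / x_t]. *)
Lemma lines_split_direct_sum V : prufer_domain R -> h_local R -> torsion_free V ->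
  iso_direct_sum_of_ideals V -> lines_split V.
Proof.
move=> prufR hl tf [I [J [f [g fK gK]]]] x x0.
pose p (y : V) : {classic I} -> R := val (f y).
have pL t (a : R) (u v : V) : p (a *: u + v) t = a * p u t + p v t.
  by rewrite /p !linearP.
have pI u v : (forall t, p u t = p v t) -> u = v.
  by move=> uv; apply: (can_inj fK); apply: val_inj; apply/funext.
have p0 t : p 0 t = 0 by rewrite /p !linear0.
have pZ t (a : R) u : p (a *: u) t = a * p u t.
  by rewrite -[a *: u]addr0 pL p0 addr0.
have Jp y t : submod_set (J t) (p y t) by have [] := set_mem (valP (f y)).
have [_ /(@finite_seqP {classic I})[s0 s0E]] := set_mem (valP (f x)).
pose s := undup s0.
have sP t : t \in s = (p x t != 0).
  rewrite mem_undup; have E : (p x t <> 0) = (t \in s0) :=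
    congr1 (fun A : set {classic I} => A t) s0E.
  by apply/idP/idP => [|/eqP]; rewrite -E // => /eqP.
have us : uniq s by exact: undup_uniq.
have s_n0 : s != [::].
  apply: contra_notN x0 => /eqP sE.
  by apply: pI => t; rewrite p0; have := sP t; rewrite sE in_nil => /esym/negbFE/eqP.
have xs t : t \in s -> p x t != 0 by rewrite sP.
have [e [e1 eP]] :=
  @fractional_ideal_comparable R {classic I} s (p x) J prufR hl s_n0 us xs.
pose D t := \prod_(u <- rem t s) p x u.
pose d := \prod_(u <- s) p x u.
have dE t : t \in s -> d = p x t * D t by move=> ts; rewrite /d (big_rem _ ts).
have d0 : d != 0 by rewrite /d prodf_seq_neq0; apply/allP.
have [L LE] : exists L : {linear V -> R^o},
    L =1 (fun y => \sum_(t <- s) D t * e t * p y t).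
  apply: linear_of_fun => a u v.
  rewrite scaler_sumr -big_split; apply: eq_bigr => t _ /=.
  change (D t * e t * p (a *: u + v) t = a * (D t * e t * p u t) + D t * e t * p v t).
  by rewrite pL mulrDr mulrCA.
have Lx : L x = d.
  rewrite LE -[RHS]mulr1 -e1 mulr_sumr; apply: eq_big_seq => t ts.
  by rewrite (dE t ts) mulrAC [D t * _]mulrC.
exists L; rewrite Lx; first exact/eqP.
move=> y.
(* Here [z] is [(e_t y_t / x_t) x]. The choice of [e] puts its coordinate at [u] in [J u], and
   outside [s] the coordinates are 0. *)
have zP (t : {classic I}) : exists z, t \in s -> p x t *: z = (e t * p y t) *: x.
  have [ts|] := boolP (t \in s); last by exists 0.
  have zuP (u : {classic I}) : exists z, [/\ submod_set (J u) z, u \notin s -> z = 0 &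
      e t * p y t * p x u = p x t * z].
    have [us'|us'] := boolP (u \in s); last first.
      exists 0; split=> //; first exact: submod0.
      by move: us'; rewrite sP negbK => /eqP->; rewrite !mulr0.
    by have [z Jz zE] := eP t u _ ts us' (Jp y t); exists z.
  have [z zE] := choice zuP.
  have Sz : submod_set (direct_sum J) z.
    split=> [u|]; first by have [] := zE u.
    apply: sub_finite_set (finite_seq s) => u zu /=.
    by apply: contrapT => /negP us'; apply: zu; have [_ ->] := zE u.
  exists (g (exist _ z (mem_set Sz))) => _.
  have pz : p (g (exist _ z (mem_set Sz))) = z by rewrite /p gK.
  by apply: pI => u; rewrite !pZ pz; have [_ _ ->] := zE u.
have {zP}[z zP] := choice zP.
exists (\sum_(t <- s) z t).
rewrite LE scaler_sumr scaler_suml; apply: eq_big_seq => t ts.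
by rewrite (dE t ts) mulrC -scalerA zP // scalerA mulrA.
Qed.

(** Division by [L x] is unique in a torsion-free module, so the quotients in [lines_split] depend
    linearly on [y]. The last clause says that [rho] takes values in the saturated hull of [x]. *)
Lemma line_retraction V (x : V) : torsion_free V -> lines_split V -> x <> 0 ->
  exists2 rho : {linear V -> V}, rho x = x &
    forall y, exists r s : R, r <> 0 /\ r *: rho y = s *: x.
Proof.
move=> tf lsV /lsV[L Lx0 /choice[rho rhoE]].
have [f fE] : exists f : {linear V -> V}, f =1 rho.
  apply: linear_of_fun => a u v; apply: (scaler_tfI tf Lx0).
  rewrite rhoE linearP scalerDr scalerA mulrC -scalerA !rhoE scalerDl.
  by rewrite scalerA.
exists f => [|y]; rewrite fE; first exact: (scaler_tfI tf Lx0).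
by exists (L x), (L y).
Qed.

End LineSplit.

(** * Rational spans of initial segments of a sequence *)

Section RationalSpan.
Variables (R : idomainType) (V : lmodType R).
Implicit Types b : nat -> V.

(** With [K] the fraction field, this is the preimage in [V] of the [K]-span of the first [n]
    vectors in the tensor product of [K] and [V]. It is the least saturated submodule containing
    them. The vectors may be dependent. *)
Definition rspan_set b n : set V :=
  [set y | exists (r : R) (a : nat -> R), r <> 0 /\ r *: y = \sum_(i < n) a i *: b i].

Fact rspan_closed b n : submod_closed (mem (rspan_set b n)).
Proof.
split=> [|c u v /set_mem[r [a [/eqP r0 uE]]] /set_mem[r' [a' [/eqP r'0 vE]]]]; apply/mem_set.
  exists 1, (fun=> 0); split; first exact/eqP/oner_neq0.
  by rewrite scaler0 big1 // => i _; rewrite scale0r.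
exists (r * r'), (fun i => c * r' * a i + r * a' i); split.
  by apply/eqP; rewrite mulf_neq0.
have -> : (r * r') *: (c *: u + v) = (c * r') *: (r *: u) + r *: (r' *: v).
  by rewrite scalerDr !scalerA; congr (_ *: _ + _); ring.
rewrite uE vE !scaler_sumr -big_split; apply: eq_bigr => i _ /=.
by rewrite scalerDl !scalerA.
Qed.

Definition rspan b n : submodule V := Submodule (rspan_closed b n).

Lemma rspan_saturated b n : saturated (rspan b n).
Proof.
move=> r y /eqP r0 [r' [a [/eqP r'0 E]]]; exists (r' * r), a.
by split; [apply/eqP; rewrite mulf_neq0 | rewrite -scalerA].
Qed.

Lemma rspan_gen b n i : (i < n)%N -> submod_set (rspan b n) (b i).
Proof.
move=> ltin; exists 1, (fun j => if j == i then 1 else 0).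
split; first exact/eqP/oner_neq0.
rewrite (bigD1 (Ordinal ltin)) //= eqxx big1 ?addr0 // => j ji.
by rewrite (_ : (j == i :> nat) = false) ?scale0r //; apply/negbTE.
Qed.

Lemma rspan_sub b n (N : submodule V) : saturated N ->
  (forall i, (i < n)%N -> submod_set N (b i)) -> rspan b n `<=` N.
Proof.
move=> satN Nb y [r [a [r0 E]]]; apply: (satN r) => //; rewrite E.
by apply: submod_sum => i _; apply: submodZ; apply: Nb.
Qed.

Lemma rspan_mono b n k : (n <= k)%N -> rspan b n `<=` rspan b k.
Proof.
move=> lenk; apply: rspan_sub; first exact: rspan_saturated.
by move=> i ltin; apply: rspan_gen; apply: leq_trans lenk.
Qed.

Lemma rspan_fixed b n (f : {linear V -> V}) y : torsion_free V ->
  (forall i, (i < n)%N -> f (b i) = b i) -> submod_set (rspan b n) y -> f y = y.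
Proof.
move=> tf fb [r [a [r0 E]]]; apply: (scaler_tfI tf r0).
have := congr1 f E; rewrite linearZ linear_sum /= => ->; rewrite E.
by apply: eq_bigr => i _; rewrite linearZ /= fb.
Qed.

(** By induction: with [x = b n - f (b n)] and [rho] the retraction onto the line of [x], the next
    projection is [f + rho (1 - f)]. If [x = 0], then [b n] is already fixed and [f] serves
    again. *)
Lemma rspan_projection b n : torsion_free V -> lines_split V ->
  exists2 f : {linear V -> V}, forall y, submod_set (rspan b n) (f y) &
    forall i, (i < n)%N -> f (b i) = b i.
Proof.
move=> tf lsV; elim: n => [|n [f fS fb]].
  have [f fE] : exists f : {linear V -> V}, f =1 (fun=> 0).
    by apply: linear_of_fun => a u v; rewrite scaler0 addr0.
  by exists f => // y; rewrite fE; exact: submod0.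
have [xE|x0] := EM (b n - f (b n) = 0).
  exists f => [y|i]; first exact: (@rspan_mono b n n.+1).
  rewrite ltnS leq_eqVlt => /orP[/eqP->|]; last exact: fb.
  by apply/esym/eqP; rewrite -subr_eq0 xE.
have [rho rhox rhoP] := line_retraction tf lsV x0.
have [h hE] : exists h : {linear V -> V}, h =1 (fun y => f y + rho (y - f y)).
  apply: linear_of_fun => a u v; 
  have -> : a *: u + v - f (a *: u + v) = a *: (u - f u) + (v - f v).
    by rewrite linearP scalerBr opprD addrACA.
  by rewrite !linearP /= scalerDr addrACA.
have subS : rspan b n `<=` rspan b n.+1 by exact: rspan_mono.
exists h => [y|i]; rewrite hE.
  apply: submodD; first exact: subS.
  have [r [s [r0 rsE]]] := rhoP (y - f y).
  apply: (rspan_saturated r0); rewrite rsE; apply: submodZ; apply: submodB.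
    exact: rspan_gen.
  exact: subS.
rewrite ltnS leq_eqVlt => /orP[/eqP->|/fb->]; first by rewrite rhox addrC subrK.
by rewrite subrr linear0 addr0.
Qed.

End RationalSpan.

(** * Direct sums assembled from independent submodules embedded in [R] *)

Section Assembly.
Variables (R : idomainType) (V : lmodType R).
Variables (C : nat -> submodule V) (g : nat -> V -> R^o).
Hypothesis gL : forall i (a : R) u v, submod_set (C i) u -> submod_set (C i) v ->
  g i (a *: u + v) = a *: g i u + g i v.
Hypothesis gI : forall i u, submod_set (C i) u -> g i u = 0 -> u = 0.
Hypothesis C_indep : forall (c : nat -> V) k, (forall i, submod_set (C i) (c i)) ->
  \sum_(i < k) c i = 0 -> forall i, (i < k)%N -> c i = 0.

(** Asking for all large [K] makes linear combinations immediate, and still forces [c i = 0] for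
    large [i]. *)
Definition decomposition (x : V) (c : nat -> V) : Prop :=
  (forall i, submod_set (C i) (c i)) /\
  exists k, forall K, (k <= K)%N -> x = \sum_(i < K) c i.

Lemma decomposition_fin k (c : nat -> V) : (forall i, submod_set (C i) (c i)) ->
  (forall i, (k <= i)%N -> c i = 0) -> decomposition (\sum_(i < k) c i) c.
Proof.
move=> Cc c0; split=> //; exists k; elim=> [|K IHK].
  by rewrite leqn0 => /eqP->.
rewrite leq_eqVlt => /orP[/eqP->//|]; rewrite ltnS => kK.
by rewrite big_ord_recr /= -IHK // c0 // addr0.
Qed.

Lemma decompositionP x c : decomposition x c ->
  exists k, (forall i, (k <= i)%N -> c i = 0) /\ x = \sum_(i < k) c i.
Proof.
move=> [_ [k kP]]; exists k; split=> [i ki|]; last exact: kP.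
have := kP i.+1 (leqW ki); rewrite big_ord_recr /= -(kP i ki).
by move=> /eqP; rewrite -subr_eq0 opprD addNKr oppr_eq0 => /eqP.
Qed.

Lemma decompositionD (a : R) u v c d : decomposition u c -> decomposition v d ->
  decomposition (a *: u + v) (fun i => a *: c i + d i).
Proof.
move=> [Cc [k kP]] [Cd [l lP]]; split=> [i|]; first exact: submodZD.
exists (maxn k l) => K; rewrite geq_max => /andP[/kP-> /lP->].
by rewrite scaler_sumr -big_split.
Qed.

Lemma decomposition_unique x c d : decomposition x c -> decomposition x d -> c = d.
Proof.
move=> xc xd; have [Ce [k kP]] := decompositionD (-1) xd xc; apply/funext => i.
apply/eqP; rewrite -subr_eq0; apply/eqP.
have := C_indep (k := maxn k i.+1) Ce => /(_ _ i).
rewrite -kP ?leq_maxl // !scaleN1r addNr leq_maxr addrC; exact.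
Qed.

(** The summands are the images [J i] of [C i] under [g i], and [x] goes to the family
    [g i (c x i)]. Uniqueness of decompositions makes this linear; lifting a finitely supported
    family through the [g i] makes it surjective. *)
Lemma direct_sum_of_decompositions : (forall x, exists c, decomposition x c) ->
  iso_direct_sum_of_ideals V.
Proof.
move=> /choice[c cP].
have g0 i : g i 0 = 0.
  have := gL 1 (submod0 (C i)) (submod0 (C i)).
  by rewrite !scale1r addr0 => /eqP; rewrite -subr_eq0 opprD addNKr oppr_eq0 => /eqP.
have JP i : exists J : ideal R, forall a, submod_set J a <->
    exists2 u, submod_set (C i) u & g i u = a.
  have [||J JE] := @submodule_of_set R R^o
    [set a | exists2 u, submod_set (C i) u & g i u = a].
  - by exists 0; [exact: submod0 | exact: g0].
  - move=> a _ _ [u Cu <-] [v Cv <-]; exists (a *: u + v); last exact: gL.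
    exact: submodZD.
  by exists J => a; rewrite JE.
have {JP}[J JP] := choice JP.
have FP x : submod_set (direct_sum J) (fun i => g i (c x i)).
  have [k [ck _]] := decompositionP (cP x); have [Cc _] := cP x.
  split=> [i|]; first by apply/JP; exists (c x i).
  apply: sub_finite_set (finite_II k) => i /= gi.
  by rewrite ltnNge; apply/negP => /ck ci; apply: gi; rewrite ci g0.
pose F x : direct_sum J :=
  exist (fun h => h \in submod_set (direct_sum J)) _ (mem_set (FP x)).
have [f fE] : exists f : {linear V -> direct_sum J}, f =1 F.
  apply: linear_of_fun => a u v; apply: val_inj; apply/funext => i.
  rewrite /= (decomposition_unique (cP _) (decompositionD a (cP u) (cP v))) /=.
  by rewrite gL //; [case: (cP u) | case: (cP v)].
exists nat, J, f.
have Finj x : f x = 0 -> x = 0.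
  rewrite fE => /(congr1 val) Fx0; have [k [_ ->]] := decompositionP (cP x).
  apply: big1 => i _; apply: (@gI i); first by case: (cP x).
  exact: (congr1 (fun h => h (i : nat)) Fx0).
have Fsurj h : exists x, f x = h.
  have [Jh /finite_seqP[s sE]] := set_mem (valP h).
  have dP i : exists u, submod_set (C i) u /\ g i u = val h i.
    by have /JP[u Cu uE] := Jh i; exists u.
  have {dP}[d dP] := choice dP.
  have [k hk] : exists k, forall i, (k <= i)%N -> val h i = 0.
    exists (\max_(i <- s) i.+1) => i; apply: contraTeq => /eqP hi.
    have is_ : i \in s by have : [set` s] i by rewrite -sE.
    by rewrite -ltnNge (big_rem _ is_) /= leq_max leqnn.
  have d0 i : (k <= i)%N -> d i = 0.
    by move=> /hk hi; have [Cd dE] := dP i; apply: gI Cd _; rewrite dE.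
  exists (\sum_(i < k) d i); rewrite fE; apply: val_inj; apply/funext => i /=.
  rewrite (decomposition_unique (cP _) (decomposition_fin (fun i => (dP i).1) d0)).
  by have [] := dP i.
have [f' f'K] := choice Fsurj; exists f' => // x.
by apply/eqP; rewrite -subr_eq0; apply/eqP/Finj; rewrite linearB f'K subrr.
Qed.

End Assembly.

(** * Splitting the filtration by rational spans *)

Section Filtration.
Variables (R : idomainType) (V : lmodType R).
Hypothesis V_tf : torsion_free V.

(** Inside [W = rspan b n.+1], the complement [C] is the kernel of the projection [f] onto the
    [n]-th span. It has rank at most one, so a functional splitting its line embeds it in [R]. *)
Lemma rspan_step (b : nat -> V) n : lines_split (rspan b n.+1) ->
  exists (C : submodule V) (g : V -> R^o), [/\ C `<=` rspan b n.+1,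
    forall y, submod_set C y -> submod_set (rspan b n) y -> y = 0,
    forall y, submod_set (rspan b n.+1) y ->
      exists2 u, submod_set (rspan b n) u & submod_set C (y - u),
    forall (a : R) u v, submod_set C u -> submod_set C v ->
      g (a *: u + v) = a *: g u + g v &
    forall u, submod_set C u -> g u = 0 -> u = 0].
Proof.
pose W : lmodType R := rspan b n.+1; move=> lsW.
have W_tf : torsion_free W by exact: torsion_free_submod.
have inW y : submod_set (rspan b n.+1) y -> exists w : W, val w = y.
  by move=> Sy; exists (exist _ y (mem_set Sy)).
have [b' b'E] : exists b' : nat -> W, forall i, (i < n.+1)%N -> val (b' i) = b i.
  have /choice[b' b'P] i : exists w : W, (i < n.+1)%N -> val w = b i.
    have [/rspan_gen/inW[w wE]|_] := boolP (i < n.+1)%N; first by exists w.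
    by exists 0.
  by exists b'.
(* Up to [n.+1], spans formed inside [W] agree with those formed in [V]. *)
have rspanW k w : (k <= n.+1)%N ->
    submod_set (rspan b' k) w <-> submod_set (rspan b k) (val w).
  move=> kn.
  have vE (a : nat -> R) : val (\sum_(i < k) a i *: b' i) = \sum_(i < k) a i *: b i.
    rewrite linear_sum; apply: eq_bigr => i _; rewrite linearZ; congr (_ *: _).
    by apply: b'E; apply: leq_trans kn.
  split=> -[r [a [r0 E]]]; exists r, a; split=> //.
    by rewrite -vE -E linearZ.
  by apply: val_inj; rewrite vE -E linearZ.
have [f fS fb] := @rspan_projection R W b' n W_tf lsW.
have ffix w : submod_set (rspan b' n) w -> f w = w by exact: rspan_fixed.
have [||C CE] := @submodule_of_set R V [set u | exists2 w : W, val w = u & f w = 0].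
- by exists 0; rewrite linear0.
- move=> a _ _ [w <- fw] [w' <- fw']; exists (a *: w + w'); first by rewrite linearP.
  by rewrite linearP fw fw' scaler0 addr0.
(* Applying [1 - f] to a relation for [w] kills every term but the last. *)
have kerE w : f w = 0 -> exists r s : R, r <> 0 /\ r *: w = s *: (b' n - f (b' n)).
  move=> fw; have [r [a [r0 E]]] : submod_set (rspan b' n.+1) w.
    by apply/rspanW => //; exact: set_mem (valP w).
  exists r, (a n); split=> //; rewrite big_ord_recr /= in E.
  have := congr1 f E; rewrite linearZ /= fw scaler0 linearD linearZ /= linear_sum.
  rewrite (eq_bigr (fun i : 'I_n => a i *: b' i)) => [fE|i _]; last first.
    by rewrite linearZ /= fb.
  by rewrite -[LHS]subr0 [in X in _ - X]fE E opprD addrACA subrr add0r scalerBr.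
have [L LP] : exists L : {linear W -> R^o}, forall w, f w = 0 -> L w = 0 -> w = 0.
  (* In this degenerate case the kernel is zero, so the zero functional is injective on it. *)
  have [x0|x0] := EM (b' n - f (b' n) = 0).
    have [L _] : exists L : {linear W -> R^o}, L =1 (fun=> 0).
      by apply: linear_of_fun => a u v; rewrite scaler0 addr0.
    exists L => w /kerE[r [s [r0]]]; rewrite x0 scaler0 => /W_tf[//|-> //].
  have [L Lx _] := lsW _ x0; exists L => w /kerE[r [s [r0 rE]]] Lw.
  have := congr1 L rE; rewrite !linearZ /= Lw scaler0 => /esym/eqP.
  rewrite mulf_eq0 => /orP[/eqP s0|/eqP//].
  by move: rE; rewrite s0 scale0r => /W_tf[].
(* [L] lives on [W]; [insubd] extends it by a default to all of [V], with linearity claimed on [C]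
   only. *)
exists C, (fun u => L (insubd (0 : W) u)).
have CP u : submod_set C u -> exists2 w : W, val w = u & f w = 0 by rewrite CE.
have insW (w : W) : insubd (0 : W) (val w) = w by exact: valKd.
split.
- by move=> u /CP[w <- _]; exact: set_mem (valP w).
- move=> _ /CP[w <- fw] /rspanW-/(_ (leqnSn n))/ffix.
  by rewrite fw => <-; rewrite linear0.
- move=> y /inW[w <-]; exists (val (f w)); first by apply/rspanW.
  by rewrite CE; exists (w - f w); rewrite linearB // (ffix (f w)) ?subrr.
- move=> a _ _ /CP[w <- _] /CP[w' <- _].
  by rewrite -linearP !insW linearP.
- by move=> _ /CP[w <- fw]; rewrite insW => /(LP _ fw)->; rewrite linear0.
Qed.

(** Independence: in a vanishing sum the last term lies both in [C k] and in the [k]-th span, hence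
    is 0. Existence: an element of the [n]-th span is split step by step down to the 0-th span,
    which is 0 by torsion-freeness. *)
Lemma direct_sum_of_filtration (b : nat -> V) :
  (forall y, exists n, submod_set (rspan b n) y) ->
  (forall n, lines_split (rspan b n)) -> iso_direct_sum_of_ideals V.
Proof.
move=> bV lsb.
have [C CP] := choice (fun n => rspan_step (lsb n.+1)); have {CP}[g gP] := choice CP.
apply: (@direct_sum_of_decompositions R V C g).
- by move=> i; have [_ _ _ + _] := gP i.
- by move=> i; have [_ _ _ _] := gP i.
- move=> c k Cc; elim: k => [//|k IHk]; rewrite big_ord_recr /= => E.
  have [subC disC _ _ _] := gP k.
  have ck : c k = 0.
    apply: disC => //; rewrite -(addKr (\sum_(i < k) c i) (c k)) E addr0.
    rewrite -sub0r; apply: submodB; first exact: submod0.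
    apply: submod_sum => i _; have [subCi _ _ _ _] := gP i.
    by apply: (rspan_mono (ltn_ord i)); apply: subCi.
  move: E; rewrite ck addr0 => /IHk c0 i; rewrite ltnS leq_eqVlt.
  by move=> /orP[/eqP->|/c0].
move=> x; have [n Sx] := bV x.
suff [c [Cc [c0 ->]]] : exists c : nat -> V, (forall i, submod_set (C i) (c i)) /\
    (forall i, (n <= i)%N -> c i = 0) /\ x = \sum_(i < n) c i.
  by exists c; apply: decomposition_fin.
elim: n x Sx => [|n IHn] x Sx.
  exists (fun=> 0); split; first by move=> i; exact: submod0.
  by split=> //; case: Sx => r [a [r0]]; rewrite !big_ord0 => /V_tf[].
have [_ _ splitS _ _] := gP n; have [u Su Cxu] := splitS x Sx.
have [c [Cc [c0 uE]]] := IHn u Su.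
exists (fun i => if i == n then x - u else c i); split.
  by move=> i; case: eqP => [->|].
split=> [i ni|]; first by rewrite gtn_eqF // c0 // ltnW.
rewrite big_ord_recr /= eqxx (eq_bigr (fun i : 'I_n => c i)) -?uE ?[u + _]addrC ?subrK //.
by move=> i _; rewrite ltn_eqF.
Qed.

(** If no nonzero multiple of [y] were a combination of [B], then [y] would have coefficient 0 in
    every relation on [B] and [y], so adding [y] would contradict maximality. *)
Lemma max_lin_indep_span (B : set V) (y : V) : max_lin_indep B ->
  exists (r : R) (s : seq V) (a : V -> R),
    [/\ r <> 0, [set` s] `<=` B & r *: y = \sum_(x <- s) a x *: x].
Proof.
move=> [Bind Bmax]; have [By|nBy] := EM (B y).
  exists 1, [:: y], (fun=> 1); split; first exact/eqP/oner_neq0.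
    by move=> x /=; rewrite inE => /eqP->.
  by rewrite big_seq1.
have nC : ~ lin_indep (B `|` [set y]).
  by move=> /Bmax BE; apply: nBy; rewrite -BE; [right | left].
apply: contrapT => ny; apply: nC => s a us sC sE.
have sub_rem : [set` rem y s] `<=` B.
  move=> x /=; rewrite mem_rem_uniq // inE => /andP[/eqP xy xs].
  by have [//|] := sC x xs.
have [ys|ys] := boolP (y \in s); last first.
  apply: (Bind s a) => // x xs; have [//|xy] := sC x xs.
  by move: ys; rewrite -xy xs.
move: sE; rewrite (big_rem _ ys) /= => sE.
have ay : a y = 0.
  apply: contrapT => ay; apply: ny; exists (a y), (rem y s), (fun x => - a x).
  split=> //; rewrite -[LHS](addrK (\sum_(x <- rem y s) a x *: x)) sE sub0r -sumrN.
  by apply: eq_bigr => x _; rewrite scaleNr.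
move: sE; rewrite ay scale0r add0r => /(Bind _ _ (rem_uniq y us) sub_rem) a0 x xs.
by have [->//|xy] := eqVneq x y; apply: a0; rewrite mem_rem_uniq // inE xy.
Qed.

Lemma countable_rank_exhaustion : countable_rank V ->
  exists b : nat -> V, forall y, exists n, submod_set (rspan b n) y.
Proof.
move=> [B [maxB /(pcard_injP (U := nat))[f finj]]].
(* [b] inverts the injection [f] of [B] into the naturals, with value 0 at the indices that [f]
   misses. *)
have /choice[b bP] n : exists x, forall y, B y -> f y = n -> x = y.
  have [[x [Bx fx]]|nx] := EM (exists x, B x /\ f x = n); last first.
    by exists 0 => y By fy; exfalso; apply: nx; exists y.
  by exists x => y By fy; apply: finj; rewrite ?inE // fx fy.
exists b => y; have [r [s [a [r0 sB E]]]] := max_lin_indep_span y maxB.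
(* This bound exceeds the index of every vector used in the relation for [y]. *)
exists (\max_(x <- s) (f x).+1); set n := (X in rspan b X).
apply: (rspan_saturated r0); rewrite E big_seq; apply: submod_sum => x xs; apply: submodZ.
have <- : b (f x) = x by apply: bP => //; exact: sB.
by apply: rspan_gen; rewrite /n (big_rem _ xs) /= leq_max leqnn.
Qed.

End Filtration.

(** * Finite rank of rational spans *)

Section FiniteRank.
Variables (R : idomainType) (W : lmodType R).

(** The analogue of [rspan_set] with coefficients indexed by the vectors themselves, to match
    [lin_indep]. *)
Definition seq_hull (t : seq W) : set W :=
  [set y | exists (r : R) (a : W -> R), r <> 0 /\ r *: y = \sum_(x <- t) a x *: x].

Lemma seq_hull_submod (t : seq W) : exists N : submodule W, submod_set N = seq_hull t.
Proof.
apply: submodule_of_set => [|c u v [r [a [/eqP r0 uE]]] [r' [a' [/eqP r'0 vE]]]].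
  exists 1, (fun=> 0); split; first exact/eqP/oner_neq0.
  by rewrite scaler0 big1 // => i _; rewrite scale0r.
exists (r * r'), (fun x => c * r' * a x + r * a' x); split.
  by apply/eqP; rewrite mulf_neq0.
have -> : (r * r') *: (c *: u + v) = (c * r') *: (r *: u) + r *: (r' *: v).
  by rewrite scalerDr !scalerA; congr (_ *: _ + _); ring.
rewrite uE vE !scaler_sumr -big_split; apply: eq_bigr => x _ /=.
by rewrite scalerDl !scalerA.
Qed.

Lemma seq_hull_mem (t : seq W) x : uniq t -> x \in t -> seq_hull t x.
Proof.
move=> ut xt; exists 1, (fun y => if y == x then 1 else 0).
split; first exact/eqP/oner_neq0.
rewrite (bigD1_seq x) //= eqxx big1 ?addr0 // => y /negbTE->.
by rewrite scale0r.
Qed.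

Lemma lin_indep_seq (t : seq W) : uniq t ->
  (forall a : W -> R, \sum_(x <- t) a x *: x = 0 -> forall x, x \in t -> a x = 0) ->
  lin_indep [set` t].
Proof.
move=> ut tind s a us st E x xs.
(* A relation on a sublist is extended by zero to all of [t]. *)
have := tind (fun y => if y \in s then a y else 0) _ x (st x xs).
rewrite xs; apply; rewrite -[RHS]E.
under eq_bigr => y _ do rewrite (fun_if (fun c => c *: y)) scale0r.
rewrite -big_mkcond -big_filter; apply: perm_big; apply: uniq_perm => //.
  exact: filter_uniq.
by move=> y; rewrite mem_filter; apply: andb_idr => /st.
Qed.

(** Greedy choice: a vector is kept only if it does not depend on those already kept. *)
Lemma lin_indep_basis_seq (s : seq W) : exists t : seq W,
  [/\ uniq t, lin_indep [set` t] & forall x, x \in s -> seq_hull t x].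
Proof.
elim: s => [|x s [t [ut tind ts]]].
  by exists [::]; split=> // s a _ s0 _ x /s0.
have [xt|xt] := EM (seq_hull t x).
  by exists t; split=> // y; rewrite inE => /orP[/eqP->|/ts].
have nxt : x \notin t by apply/negP => /(seq_hull_mem ut).
have uxt : uniq (x :: t) by rewrite /= nxt.
exists (x :: t); split=> //.
  apply: lin_indep_seq => // a; rewrite big_cons => E.
  have ax : a x = 0.
    apply: contrapT => ax; apply: xt; exists (a x), (fun y => - a y); split=> //.
    rewrite -[LHS](addrK (\sum_(y <- t) a y *: y)) E sub0r -sumrN.
    by apply: eq_bigr => y _; rewrite scaleNr.
  move: E; rewrite ax scale0r add0r => /(tind t a ut (@subset_refl _ _)) a0 y.
  by rewrite inE => /orP[/eqP->|/a0].
move=> y; rewrite inE => /orP[/eqP->|/ts[r [a [r0 E]]]].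
  by apply: seq_hull_mem => //; exact: mem_head.
exists r, (fun z => if z == x then 0 else a z); split=> //.
rewrite big_cons eqxx scale0r add0r E; apply: eq_big_seq => z zt.
by rewrite ifN //; apply: contraNneq nxt => <-.
Qed.

(** The hypothesis puts a nonzero multiple of each [y] in the span of [s]. Quantifying over
    submodules lets it be applied directly to the hull of an independent list extracted from [s]. *)
Lemma finite_rank_seq (s : seq W) :
  (forall y, exists2 r : R, r <> 0 &
     forall N : submodule W, [set` s] `<=` N -> submod_set N (r *: y)) ->
  finite_rank W.
Proof.
move=> sW; have [t [ut tind ts]] := lin_indep_basis_seq s.
have [N NE] := seq_hull_submod t.
have tW y : seq_hull t y.
  have [r /eqP r0 /(_ N)] := sW y.
  rewrite NE => /(_ ts)[r' [a' [/eqP r'0 E']]].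
  exists (r' * r), a'; split; first by apply/eqP; rewrite mulf_neq0.
  by rewrite -scalerA.
exists [set` t]; split; last exact: finite_seq.
split=> // C Cind tC; apply/seteqP; split=> // y Cy /=.
apply: contrapT => /negP yt; have [r [a [r0 E]]] := tW y.
have := Cind (y :: t) (fun x => if x == y then r else - a x) _ _ _ y (mem_head _ _).
rewrite eqxx => H; apply: r0; apply: H => //=; first by rewrite yt.
  by move=> x /=; rewrite inE => /orP[/eqP->|/tC].
rewrite big_cons eqxx E -big_split big1_seq // => x /andP[_ xt] /=.
have -> : x == y = false by apply/negbTE; apply: contraNneq yt => <-.
by rewrite scaleNr subrr.
Qed.

End FiniteRank.

Lemma rspan_finite_rank (R : idomainType) (V : lmodType R) (b : nat -> V) n :
  finite_rank (rspan b n).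
Proof.
pose W : lmodType R := rspan b n.
have /choice[b' b'P] (i : 'I_n) : exists w : W, val w = b i.
  by exists (exist _ (b i) (mem_set (rspan_gen b (ltn_ord i)))).
apply: (@finite_rank_seq R W [seq b' i | i <- enum 'I_n]) => y.
have [r [a [r0 E]]] := set_mem (valP y); exists r => // N sN.
have -> : r *: y = \sum_(i < n) a i *: b' i.
  apply: val_inj; rewrite linearZ linear_sum [LHS]E; apply: eq_bigr => i _.
  by rewrite linearZ; congr (_ *: _); rewrite -b'P.
by apply: submod_sum => i _; apply: submodZ; apply: sN; apply: map_f; rewrite mem_enum.
Qed.

(** * Saturated submodules are pure *)

Section Purity.
Variables (R : idomainType) (V : lmodType R) (N : submodule V).
Hypotheses (R_prufer : prufer_domain R) (R_hlocal : h_local R).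
Hypothesis N_sat : saturated N.

(* Prufer comparability makes one coefficient of a relation c among the x j
   modulo N a divisor of all the others, up to the weights e of a partition of
   unity: this eliminates the corresponding x i. *)
Lemma saturated_approximation (I : finType) (x : I -> V) (D : {set I}) :
  exists n : I -> V, (forall i, submod_set N (n i)) /\
    forall r : I -> R, submod_set N (\sum_(j in D) r j *: x j) ->
      \sum_(j in D) r j *: n j = \sum_(j in D) r j *: x j.
Proof.
elim: {D}_.+1 {-2}D (ltnSn #|D|) => // k IHk D leDk.
(* If the [x j] are independent modulo [N], the only admissible [r] vanishes on [D] and [n = 0]
   works. *)
have [indep|] := EM (forall c : I -> R, submod_set N (\sum_(j in D) c j *: x j) ->
    forall j, j \in D -> c j = 0).
  exists (fun=> 0); split=> [i|r /indep r0]; first exact: submod0.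
  by rewrite !big1 // => i iD; rewrite r0 // scale0r.
move=> /existsNP[c /not_implyP[Nc /existsNP[j0 /not_implyP[j0D cj0]]]].
pose s := [seq j <- enum D | c j != 0].
have sE j : (j \in s) = (c j != 0) && (j \in D) by rewrite mem_filter mem_enum.
have s0 : s != [::].
  have : j0 \in s by rewrite sE j0D andbT; apply/eqP.
  by case: (s).
have us : uniq s by rewrite filter_uniq // enum_uniq.
have cs j : j \in s -> c j != 0 by rewrite sE => /andP[].
(* Comparability is applied to the fractional ideals [R / c_j], so every [J t] is the unit ideal. *)
have [I1 I1E] := principal_ideal (1 : R).
have [e [e1 eP]] :=
  fractional_ideal_comparable (fun=> I1) R_prufer R_hlocal s0 us cs.
(* [d (i, j)] is the quotient [e i * c j / c i]. *)
have /choice[d dP] (ij : I * I) : exists d : R,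
    ij.1 \in s -> ij.2 \in D -> e ij.1 * c ij.2 = c ij.1 * d.
  case: ij => i j /=; have [iS|_] := boolP (i \in s); last by exists 0.
  have [cj0'|cj] := eqVneq (c j) 0; first by exists 0; rewrite cj0' !mulr0.
  have [jD|_] := boolP (j \in D); last by exists 0.
  have [||z _ zE] := eP i j 1 iS; first by rewrite sE cj.
    by apply/I1E; exists 1; rewrite mul1r.
  by exists z => _ _; rewrite -zE mulr1.
have /choice[m mP] (i : I) : exists m : I -> V, i \in s ->
    (forall j, submod_set N (m j)) /\
    forall r : I -> R, submod_set N (\sum_(j in D) r j *: x j) ->
      \sum_(j in D) r j *: m j = e i *: \sum_(j in D) r j *: x j.
  have [iS|_] := boolP (i \in s); last by exists x.
  have /andP[/eqP ci iD] : (c i != 0) && (i \in D) by rewrite -sE.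
  have [|n [Nn nP]] := IHk (D :\ i).
    by move: leDk; rewrite (cardsD1 i D) iD.
  (* [w] is [e i / c i] times the relation, hence in [N] by saturation, and its coefficient at [x i]
     is [e i]. Subtracting [r i *: w] from [e i] times a combination thus removes [x i], and the
     induction hypothesis handles the rest. *)
  pose w := \sum_(j in D) d (i, j) *: x j.
  have Nw : submod_set N w.
    apply: (N_sat ci); rewrite /w scaler_sumr.
    rewrite (eq_bigr (fun j => e i *: (c j *: x j))) => [|j jD].
      by rewrite -scaler_sumr; apply: submodZ.
    by rewrite !scalerA -(dP (i, j)).
  have dii : d (i, i) = e i.
    by apply: (mulfI (introN eqP ci)); rewrite -(dP (i, i)) // mulrC.
  pose v := \sum_(j in D :\ i) d (i, j) *: n j.
  exists (fun j => if j == i then w - v else e i *: n j).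
  move=> _; split=> [j|r Nr].
    case: eqP => _; last exact: submodZ.
    by apply: submodB => //; apply: submod_sum => l _; apply: submodZ.
  rewrite (big_setD1 i iD) /= eqxx.
  rewrite (eq_bigr (fun j => r j *: (e i *: n j))) => [|j]; last first.
    by case/setD1P => /negPf->.
  have E : \sum_(j in D :\ i) (e i * r j - r i * d (i, j)) *: x j =
      e i *: (\sum_(j in D) r j *: x j) - r i *: w.
    rewrite /w !(big_setD1 i iD) /= dii !scalerDr !scalerA [r i * e i]mulrC.
    rewrite opprD addrACA subrr add0r !scaler_sumr -sumrB.
    by apply: eq_bigr => j _; rewrite scalerBl !scalerA.
  have := nP (fun j => e i * r j - r i * d (i, j)); rewrite E => /(_ _)/esym nE.
  rewrite -[RHS](subrK (r i *: w)) nE; last by apply: submodB; apply: submodZ.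
  rewrite scalerBr /v addrAC [RHS]addrC -addrA; congr (_ + _).
  rewrite scaler_sumr -sumrB; apply: eq_bigr => j _.
  by rewrite scalerBl !scalerA [r j * _]mulrC.
(* Each [m i] reproduces [e i] times the combination, and the weights sum to 1. *)
exists (fun j => \sum_(i <- s) m i j); split=> [j|r Nr].
  by rewrite big_seq; apply: submod_sum => i /mP[].
under eq_bigr => j _ do rewrite scaler_sumr.
rewrite exchange_big /= -[RHS]scale1r -e1 scaler_suml; apply: eq_big_seq => i iS.
by have [_ ->] := mP i iS.
Qed.

(** One family [y] in [N] replaces the solution [x] in all rows at once, since each row sum [a i] is
    in [N]. *)
Lemma saturated_pure : pure N.
Proof.
move=> n m r a Na [x xE].
have [y [Ny yE]] := saturated_approximation x (finset.setTfor 'I_m).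
have sumT (F : 'I_m -> V) : \sum_(j in (finset.setTfor 'I_m)) F j = \sum_j F j.
  by apply: eq_bigl => j; rewrite finset.inE.
exists y; split=> // i; have := yE (r i); rewrite !sumT xE; exact.
Qed.

End Purity.

Theorem theorem8 (R : idomainType) (R_prufer : prufer_domain R)
    (R_hlocal : h_local R) (M : lmodType R) (M_tf : torsion_free M)
    (M_rank : countable_rank M) :
  iso_direct_sum_of_ideals M <->
  (forall N : submodule M, finite_rank N -> pure N ->
     iso_direct_sum_of_ideals N).
Proof.
split=> [M_sum N [B [maxB finB]] N_pure|M_fin].
  have N_tf : torsion_free N by exact: torsion_free_submod.
  (* Splitting of lines passes from [M] to the pure submodule [N], and from [N] to the spans that
     exhaust it. *)
  have N_lines : lines_split N.
    apply: lines_split_submod; first exact: pure_saturated.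
    exact: lines_split_direct_sum.
  have [|b bN] := @countable_rank_exhaustion R N.
    by exists B; split=> //; exact: finite_set_countable.
  apply: (direct_sum_of_filtration N_tf bN) => n.
  by apply: lines_split_submod => //; exact: rspan_saturated.
(* Conversely, each span exhausting [M] is pure of finite rank, hence a direct sum of ideals by
   hypothesis, so its lines split. *)
have [b bM] := countable_rank_exhaustion M_rank.
apply: (direct_sum_of_filtration M_tf bM) => n.
apply: lines_split_direct_sum => //; first exact: torsion_free_submod.
apply: M_fin; first exact: rspan_finite_rank.
by apply: saturated_pure => //; exact: rspan_saturated.
Qed.
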